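(* Let $L$ be a finite join-semidistributive lattice. Then the following are equivalent: (i) $L$ is a lower bounded homomorphic image of a free lattice; (ii) $\mathrm{Dim}\,L$ is strongly separative; (iii) $\mathrm{Dim}\,L$ satisfies the axiom $(\forall x)(2x=x\Rightarrow x=0)$.
   Context: A lattice $L$ is join-semidistributive if $x\vee y=x\vee z$ implies $x\vee y=x\vee(y\wedge z)$ for all $x,y,z\in L$. A lattice homomorphism $f\colon K\to L$ is lower bounded if for every $a\in L$ the set $\{x\in K\mid a\le f(x)\}$ is either empty or has a least element. $L$ is a lower bounded homomorphic image of a free lattice if it is the image of a finitely generated free lattice under a lower bounded lattice homomorphism. The dimension monoid $\mathrm{Dim}\,L$ of a lattice $L$ is the commutative monoid (with zero element $0$) defined by generators $\Delta(x,y)$, for $x\le y$ in $L$, and relations: $\Delta(x,x)=0$; $\Delta(x,z)=\Delta(x,y)+\Delta(y,z)$ for $x\le y\le z$; $\Delta(x\wedge y,x)=\Delta(y,x\vee y)$, for all $x,y,z\in L$. A commutative monoid $M$ is strongly separative if $a+b=2b$ implies $a=b$, for all $a,b\in M$. *)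

(* Defs.v *)
From HB Require Import structures.
From mathcomp Require Import all_boot all_order ssralg generic_quotient.
From mathcomp Require Import boolp.

Set Implicit Arguments.
Unset Strict Implicit.
Unset Printing Implicit Defensive.

Import Order.TTheory GRing.Theory.
Local Open Scope order_scope.
Local Open Scope quotient_scope.

Definition join_semidistributive d (L : latticeType d) : Prop :=
  forall x y z : L, x `|` y = x `|` z -> x `|` y = x `|` (y `&` z).

(* Order.LatticeMorphism requires preservation of binary meets and joins only,
   not of bounds. *)
Definition lower_bounded dK (K : latticeType dK) dL (L : latticeType dL)
    (f : {lmorphism K -> L}) : Prop :=
  forall a : L,
    (forall x : K, ~ a <= f x) \/
    (exists2 m : K, a <= f m & forall x : K, a <= f x -> m <= x).

(* F is the free lattice on the family X of generators, by its universal
   property in the category of all lattices (bounds play no role). *)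
Definition free_lattice (I : Type) d (F : latticeType d) (X : I -> F) : Prop :=
  forall (d' : Order.disp_t) (M : latticeType d') (g : I -> M),
    (exists h : {lmorphism F -> M}, forall i, h (X i) = g i) /\
    (forall h1 h2 : {lmorphism F -> M},
        (forall i, h1 (X i) = g i) -> (forall i, h2 (X i) = g i) -> h1 =1 h2).

Definition lower_bounded_image_of_free d (L : latticeType d) : Prop :=
  exists (n : nat) (d' : Order.disp_t) (F : latticeType d') (X : 'I_n -> F),
    free_lattice X /\
    exists f : {lmorphism F -> L},
      lower_bounded f /\ (forall y : L, exists x : F, f x = y).

(* Commutative monoids presented by generators G and relations R: a word
   [:: g1; ...; gk] stands for the formal sum g1 + ... + gk, and
   words are identified modulo the least monoid congruence that contains R and
   makes concatenation commutative. *)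
Section Presentation.
Variables (G : choiceType) (R : seq G -> seq G -> Prop).

Inductive pres_cong : seq G -> seq G -> Prop :=
| pres_rel s t : R s t -> pres_cong s t
| pres_comm s t : pres_cong (s ++ t) (t ++ s)
| pres_cat s1 t1 s2 t2 :
    pres_cong s1 t1 -> pres_cong s2 t2 -> pres_cong (s1 ++ s2) (t1 ++ t2)
| pres_refl s : pres_cong s s
| pres_sym s t : pres_cong s t -> pres_cong t s
| pres_trans s t u : pres_cong s t -> pres_cong t u -> pres_cong s u.

Definition pres_eqv (s t : seq G) : bool := `[< pres_cong s t >].

Lemma pres_eqv_refl : reflexive pres_eqv.
Proof. by move=> s; apply/asboolP; apply: pres_refl. Qed.

Lemma pres_eqv_sym : symmetric pres_eqv.
Proof. by move=> s t; apply/asboolP/asboolP; apply: pres_sym. Qed.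

Lemma pres_eqv_trans : transitive pres_eqv.
Proof.
by move=> t s u /asboolP st /asboolP tu; apply/asboolP; apply: pres_trans tu.
Qed.

Canonical pres_equiv := EquivRel pres_eqv pres_eqv_refl pres_eqv_sym pres_eqv_trans.

Definition presented : Type := {eq_quot pres_equiv}.

HB.instance Definition _ := Choice.on presented.

Definition pres_class (s : seq G) : presented := \pi_({eq_quot pres_equiv}) s.
Definition pres_repr (a : presented) : seq G := repr (a : {eq_quot pres_equiv}).

Lemma pres_reprK : cancel pres_repr pres_class.
Proof. by move=> a; exact: reprK. Qed.

Lemma pres_classP s t : pres_class s = pres_class t <-> pres_cong s t.
Proof.
split; first by move=> /eqmodP /asboolP.
by move=> st; apply/eqmodP/asboolP.
Qed.

Definition pres_zero : presented := pres_class [::].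
Definition pres_add (a b : presented) : presented :=
  pres_class (pres_repr a ++ pres_repr b).

Lemma pres_add_class s t :
  pres_add (pres_class s) (pres_class t) = pres_class (s ++ t).
Proof.
by apply/pres_classP; apply: pres_cat; apply/pres_classP; rewrite pres_reprK.
Qed.

Lemma pres_addA : associative pres_add.
Proof.
move=> a b c; rewrite -(pres_reprK a) -(pres_reprK b) -(pres_reprK c).
by rewrite !pres_add_class catA.
Qed.

Lemma pres_addC : commutative pres_add.
Proof. by move=> a b; apply/pres_classP; apply: pres_comm. Qed.

Lemma pres_add0 : left_id pres_zero pres_add.
Proof. by move=> a; rewrite -(pres_reprK a) pres_add_class. Qed.

HB.instance Definition _ :=
  GRing.isNmodule.Build presented pres_addA pres_addC pres_add0.

Lemma pres_classD s t :
  pres_class (s ++ t) = (pres_class s + pres_class t)%R.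
Proof. by rewrite -pres_add_class. Qed.

Lemma pres_class0 : pres_class [::] = 0%R.
Proof. by []. Qed.

Lemma pres_lift (M : nmodType) (g : G -> M) :
  (forall s t, R s t -> (\sum_(x <- s) g x = \sum_(x <- t) g x)%R) ->
  exists h : presented -> M,
    [/\ h 0%R = 0%R, {morph h : a b / (a + b)%R} &
        forall x, h (pres_class [:: x]) = g x].
Proof.
move=> gR; pose h a := (\sum_(x <- pres_repr a) g x)%R.
have gE s t : pres_cong s t -> (\sum_(x <- s) g x = \sum_(x <- t) g x)%R.
  elim=> [u v|u v|u1 v1 u2 v2 _ e1 _ e2|//|u v _ ->//|u v w _ -> _ ->//].
  - exact: gR.
  - by rewrite !big_cat /= addrC.
  - by rewrite !big_cat /= e1 e2.
have hE s : h (pres_class s) = (\sum_(x <- s) g x)%R.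
  by apply: gE; apply/pres_classP; rewrite pres_reprK.
exists h; split; first by rewrite -pres_class0 hE big_nil.
  move=> a b; rewrite -(pres_reprK a) -(pres_reprK b) -pres_classD !hE.
  by rewrite big_cat.
by move=> x; rewrite hE big_seq1.
Qed.

End Presentation.

Section DimensionMonoid.
Variables (d : Order.disp_t) (L : latticeType d).

Definition dim_gen : Type := {p : L * L | p.1 <= p.2}.
HB.instance Definition _ := Choice.on dim_gen.

Definition mk_dim_gen (x y : L) (xy : x <= y) : dim_gen :=
  exist (fun p : L * L => p.1 <= p.2) (x, y) xy.

Inductive dim_rel : seq dim_gen -> seq dim_gen -> Prop :=
| dim_rel0 x : dim_rel [:: mk_dim_gen (lexx x)] [::]
| dim_relD x y z (xy : x <= y) (yz : y <= z) :
    dim_rel [:: mk_dim_gen (le_trans xy yz)]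
            [:: mk_dim_gen xy; mk_dim_gen yz]
| dim_relIU x y :
    dim_rel [:: mk_dim_gen (leIl x y)] [:: mk_dim_gen (leUr y x)].

Definition Dim : Type := presented dim_rel.
HB.instance Definition _ := GRing.Nmodule.on Dim.

Definition Delta (x y : L) (xy : x <= y) : Dim :=
  pres_class dim_rel [:: mk_dim_gen xy].

Lemma Delta_id x : Delta (lexx x) = 0%R.
Proof. by apply/pres_classP; apply: pres_rel; apply: dim_rel0. Qed.

Lemma Delta_trans x y z (xy : x <= y) (yz : y <= z) :
  Delta (le_trans xy yz) = (Delta xy + Delta yz)%R.
Proof.
rewrite -[RHS]pres_classD; apply/pres_classP.
by apply: pres_rel; apply: dim_relD.
Qed.

Lemma Delta_meet_join x y :
  Delta (leIl x y : x `&` y <= x) = Delta (leUr y x : y <= x `|` y).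
Proof. by apply/pres_classP; apply: pres_rel; apply: dim_relIU. Qed.

End DimensionMonoid.

Definition strongly_separative (M : nmodType) : Prop :=
  forall a b : M, (a + b = b *+ 2)%R -> a = b.

Definition no_nonzero_idempotent (M : nmodType) : Prop :=
  forall x : M, (x *+ 2 = x)%R -> x = 0%R.

(* Main.v *)
Require Import Defs.
From HB Require Import structures.
From mathcomp Require Import all_boot all_order ssralg generic_quotient.
From mathcomp Require Import boolp.

(* Both (i) and (iii) are compared with acyclicity of the join-dependency
   relation D on the join-irreducibles of L.
   The monoid Dim L is generated by the elements [p] = Delta(lower p, p), with p
   join-irreducible and lower p its lower cover, and join-semidistributivity
   gives [p] + [q] = [q] whenever p D q. Conversely, any weight w on the
   join-irreducibles with w p + w q = w q for p D q extends to the homomorphism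
   sending Delta(x, y) to the sum of the w q with q <= y and not q <= x. The
   weights with values in nat + {infinity} given by w_p(q) = infinity if p D^+ q,
   1 if p = q, 0 otherwise, show that a D-cycle produces a nonzero idempotent
   and that, when D is acyclic, the elements of Dim L have normal forms
   (combinations of D^+-incomparable generators), which yields strong
   separativity.
   For acyclic D, least preimages in the free lattice are built by well-founded
   induction along D. Conversely, a lower bounded homomorphism from a free
   lattice is lifted to a lattice of increasing sequences of subsets of L, in
   which the stage where p first appears in the least preimage of p strictly
   decreases along D. *)

Set Implicit Arguments.
Unset Strict Implicit.
Unset Printing Implicit Defensive.

Import Order.TTheory GRing.Theory.
Local Open Scope order_scope.
Local Open Scope quotient_scope.

(** * The join-dependency relation *)

Section JoinDependency.
Variables (d : Order.disp_t) (L : finTBLatticeType d).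
Implicit Types (P : pred L) (a p q r s x y z w : L).

Lemma ex_minimal P a :
  P a -> exists2 r, P r & forall x, x < r -> ~~ P x.
Proof.
move=> Pa; case: (@arg_minnP _ a P (fun r => #|[set x | x < r]|) Pa) => r Pr rmin.
exists r => // x xr; apply/negP => /rmin; rewrite leqNgt => /negP; apply.
apply: proper_card; apply/properP; split.
  by apply/subsetP => y; rewrite !inE => /lt_trans; apply.
by exists x; rewrite !inE ?ltxx.
Qed.

Lemma ex_maximal P a :
  P a -> exists2 r, P r & forall x, r < x -> ~~ P x.
Proof.
move=> Pa; case: (@arg_minnP _ a P (fun r => #|[set x | r < x]|) Pa) => r Pr rmin.
exists r => // x xr; apply/negP => /rmin; rewrite leqNgt => /negP; apply.
apply: proper_card; apply/properP; split.
  by apply/subsetP => y; rewrite !inE; apply: lt_trans.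
by exists x; rewrite !inE ?ltxx.
Qed.

(* The lower cover of p if p is join-irreducible, and p itself otherwise. *)
Definition lower p : L := \join_(x | x < p) x.
Definition join_irreducible p := lower p < p.

Lemma lower_le p : lower p <= p.
Proof. by apply/joinsP => x /ltW. Qed.

Lemma lt_lower x p : x < p -> x <= lower p.
Proof. by move=> xp; exact: (joins_sup id). Qed.

Lemma le_lower x p : x <= p -> x != p -> x <= lower p.
Proof. by move=> xp np; apply: lt_lower; rewrite lt_neqAle np. Qed.

(** A minimal element among those below [a] and not below [z] works: whatever lies strictly under it
    is below [z]. *)
Lemma join_irreducible_below a z : ~~ (a <= z) ->
  exists r, [/\ join_irreducible r, r <= a, ~~ (r <= z) & lower r <= z].
Proof.
move=> az.
have [|r /andP[ra rz] rmin] := @ex_minimal (fun r => (r <= a) && ~~ (r <= z)) a.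
  by rewrite lexx.
have lz : lower r <= z.
  apply/joinsP => x xr; have := rmin x xr.
  by rewrite (le_trans (ltW xr) ra) /= negbK.
exists r; split => //; rewrite /join_irreducible lt_neqAle lower_le andbT.
by apply: contraNneq rz => <-.
Qed.

Lemma ex_maximal_avoiding p s : ~~ (p <= s) ->
  exists z, [/\ s <= z, ~~ (p <= z) &
    forall w, ~~ (w <= z) -> p <= w `|` z].
Proof.
move=> ps.
have [|z /andP[sz pz] zmax] := @ex_maximal (fun z => (s <= z) && ~~ (p <= z)) s.
  by rewrite lexx.
exists z; split=> // w wz.
have := zmax (w `|` z); rewrite lt_neqAle leUr andbT.
rewrite (le_trans sz (leUr _ _)) /= negbK; apply.
by apply: contraNneq wz => ->; rewrite leUl.
Qed.

Definition join_dep p q :=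
  [&& p != q, join_irreducible p, join_irreducible q &
      [exists x, (p <= q `|` x) && ~~ (p <= lower q `|` x)]].

Lemma join_depP p q : reflect
  [/\ p != q, join_irreducible p, join_irreducible q &
     exists x, [/\ lower q <= x, p <= x `|` q & ~~ (p <= x)]]
  (join_dep p q).
Proof.
apply: (iffP and4P) => -[np jp jq].
  move=> /existsP[x /andP[h1 h2]]; split=> //; exists (lower q `|` x).
  split=> //; first exact: leUl.
  by apply: le_trans h1 _; rewrite leUx leUr lexU2 ?leUr.
move=> [x [qx pxq px]]; split=> //; apply/existsP; exists x.
by rewrite joinC pxq (join_r qx).
Qed.

Lemma join_dep_nle p q : join_dep p q -> ~~ (p <= q).
Proof.
move=> /join_depP[np jp jq [x [qx _ px]]].
by apply: contra px => pq; apply: le_trans (le_lower pq np) qx.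
Qed.

(** For [r] minimal below [a] and not below [z], the maximality of [z] makes [z] itself a witness of
    p D r. *)
Lemma join_dep_below p z a : join_irreducible p -> ~~ (p <= z) ->
  (forall w, ~~ (w <= z) -> p <= w `|` z) ->
  ~~ (a <= z) -> ~~ (p <= a) ->
  exists r, [/\ join_dep p r, r <= a & ~~ (r <= z)].
Proof.
move=> jp pz zmax az pa.
have [r [jr ra rz lrz]] := join_irreducible_below az.
exists r; split=> //; apply/join_depP; split=> //.
  by apply: contraNneq pa => ->.
by exists z; split=> //; rewrite joinC zmax.
Qed.

(** [connect] is reflexive, so one step is put in front; [join_depT p p] thus means a cycle through
    [p]. *)
Definition join_depT p q := [exists r, join_dep p r && connect join_dep r q].

Lemma join_depT_dep p q : join_dep p q -> join_depT p q.
Proof. by move=> pq; apply/existsP; exists q; rewrite pq connect0. Qed.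

Lemma join_depT_trans p q r : join_depT p q -> join_depT q r -> join_depT p r.
Proof.
move=> /existsP[s /andP[ps sq]] /existsP[t /andP[qt tr]].
apply/existsP; exists s; rewrite ps /=; apply: connect_trans sq _.
exact: connect_trans (connect1 qt) tr.
Qed.

Lemma join_depT_ji p q : join_depT p q -> join_irreducible q.
Proof.
case/existsP => r /andP[pr /connectP[s rs ->]] {q}.
have jr : join_irreducible r by case/and4P: pr.
elim: s r jr rs {pr} => [//|t s IH] r jr /= /andP[rt ts].
by apply: IH ts; case/and4P: rt.
Qed.

Definition join_dep_acyclic := forall p, ~~ join_depT p p.

(** The finite set of D^+-successors strictly shrinks along D^+, since by acyclicity [q] is not
    among its own successors. *)
Lemma join_dep_ind (P : L -> Prop) : join_dep_acyclic ->
  (forall p, (forall q, join_depT p q -> P q) -> P p) -> forall p, P p.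
Proof.
move=> acyc IH p; have [n] := ubnP #|[set q | join_depT p q]|.
elim: n p => // n IHn p pn; apply: IH => q pq; apply: IHn.
apply: leq_trans (_ : (#|[set r | join_depT p r]| <= n)%N) => //.
apply: proper_card; apply/properP; split.
  by apply/subsetP => r; rewrite !inE; apply: join_depT_trans.
by exists q; rewrite !inE // acyc.
Qed.

End JoinDependency.

(** * The dimension monoid *)

Section AbsorbingSums.
Variables (M : nmodType) (I : finType).
Implicit Types (F : I -> M) (P Q : pred I).

Lemma big_absorb F P Q :
  (forall i, Q i -> exists2 j, P j & (F i + F j = F j)%R) ->
  (\sum_(i | P i) F i + \sum_(i | Q i) F i = \sum_(i | P i) F i)%R.
Proof.
move=> PQ.
apply: (big_ind (fun s => (\sum_(i | P i) F i + s = \sum_(i | P i) F i)%R)).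
- by rewrite addr0.
- by move=> a b ha hb; rewrite addrA ha.
move=> i /PQ[j Pj ij]; rewrite (bigD1 j) //=.
by rewrite addrAC [(F j + F i)%R]addrC ij.
Qed.

Lemma absorb_mulrn (a b : M) m n :
  (0 < n)%N -> (a + b = b)%R -> (a *+ m + b *+ n = b *+ n)%R.
Proof.
case: n => // n _ ab; rewrite mulrS addrA; congr (_ + _)%R.
by elim: m => [|m IH]; rewrite ?mulr0n ?add0r // mulrSr -addrA ab.
Qed.

End AbsorbingSums.

(** * Generators, absorption and homomorphisms of the dimension monoid *)

Section Dimension.
Variables (d : Order.disp_t) (L : finTBLatticeType d).
Implicit Types (a p q r s x y z w : L).

(* The value of Delta on [y `&` x, y], which is Delta(x, y) if x <= y; being
   total, it spares the proof arguments. *)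
Definition dim x y : Dim L := Delta (leIl y x).

Lemma Delta_congr x y x' y' (xy : x <= y) (xy' : x' <= y') :
  x = x' -> y = y' -> Delta xy = Delta xy'.
Proof. by move=> ex ey; subst x' y'; congr Delta; exact: bool_irrelevance. Qed.

Lemma DeltaE x y (xy : x <= y) : Delta xy = dim x y.
Proof. by apply: Delta_congr => //; rewrite meet_r. Qed.

Lemma dim_id x : dim x x = 0%R.
Proof. by rewrite -DeltaE Delta_id. Qed.

Lemma dim_trans x y z : x <= y -> y <= z -> dim x z = (dim x y + dim y z)%R.
Proof.
by move=> xy yz; rewrite -(DeltaE xy) -(DeltaE yz) -Delta_trans DeltaE.
Qed.

Lemma dimU x y : dim x (x `|` y) = dim x y.
Proof.
rewrite -(DeltaE (leUl x y)) /dim Delta_meet_join.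
by apply: Delta_congr; rewrite // joinC.
Qed.

Lemma dimI x y : dim (x `&` y) y = dim x y.
Proof. by apply: Delta_congr; rewrite // [_ `&` y]meetC meetA meetxx. Qed.

Definition dim_ji p := dim (lower p) p.

Lemma dim_jiE x q :
  lower q <= x -> ~~ (q <= x) -> dim x q = dim_ji q.
Proof.
move=> qx nqx; rewrite -dimI; congr dim; apply/eqP; rewrite eq_le lexI qx.
rewrite lower_le !andbT; apply: le_lower; first exact: leIr.
by apply: contraNneq nqx => <-; rewrite leIl.
Qed.

Lemma join_dep_absorb : join_semidistributive L ->
  forall p q, join_dep p q -> (dim_ji p + dim_ji q = dim_ji q)%R.
Proof.
move=> hL p q /join_depP[np jp jq [x [qx pxq px]]].
have nqx : ~~ (q <= x).
  by apply: contra px => h; apply: le_trans pxq _; rewrite leUx lexx.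
rewrite -(dim_jiE qx nqx).
(* In the first case [p] and [lower p] have the same join and the same meet with [x], so [dim x p]
   absorbs [p]; and [dim x p] is a summand of [dim x q], which is [q]. *)
have [pxp|pxp] := boolP (p <= x `|` lower p).
  have xpl : x `&` p <= lower p.
    by apply: le_lower; [exact: leIr | apply: contraNneq px => <-; exact: leIl].
  have xlE : x `&` lower p = x `&` p.
    apply/le_anti; rewrite !lexI !leIl xpl /= andbT.
    exact: le_trans (leIr _ _) (lower_le _).
  have xpE : dim x p = (dim x p + dim_ji p)%R.
    rewrite -[LHS]dimI (dim_trans xpl (lower_le p)) -xlE dimI.
    rewrite -(dimU x (lower p)) -(dimU x p); congr (dim _ _ + _)%R.
    by apply/le_anti; rewrite !leUx !leUl pxp lexU2 // lower_le orbT.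
  rewrite -dimU (@dim_trans _ (x `|` p)) ?leUl ?leUx ?leUl //.
  by rewrite dimU addrA [(dim_ji p + _)%R]addrC -xpE.
(* Otherwise [x] is enlarged to [u], above [lower p] and [lower q] but still not above [p], so that
   [p] is [dim u p] and [q] is [dim u q]. *)
set u := x `|` lower p in pxp.
have lqu : lower q <= u by apply: le_trans qx (leUl _ _).
have lpu : lower p <= u by exact: leUr.
have puq : p <= u `|` q by apply: le_trans pxq _; rewrite leU2 ?leUl.
clearbody u.
have qu : ~~ (q <= u).
  by apply: contra pxp => h; rewrite -(join_l h).
(* If this failed, [p] and [q] would have the same join with [u], equal by semidistributivity to the
   join of [u] with their meet. That meet is below [lower p] or [lower q], hence below [u], which
   would force [p <= u]. *)
have qup : ~~ (q <= u `|` p).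
  apply/negP => h; have e : u `|` p = u `|` q.
    by apply/le_anti; rewrite !leUx h puq !leUl.
  case/negP: pxp; have -> : u = u `|` (p `&` q); last by rewrite -hL ?leUr.
  apply/esym/join_l; have [pqp|pqp] := eqVneq (p `&` q) p.
    apply: le_trans lqu; rewrite pqp; apply: le_lower => //.
    by rewrite -pqp leIr.
  by apply: le_trans lpu; apply: le_lower => //; exact: leIl.
have lqup : lower q <= u `|` p by apply: le_trans lqu (leUl _ _).
(* Passing from [u] to its join with [q] by way of its join with [p] costs [p] and then [q] once
   more. *)
rewrite (dim_jiE qx nqx) -[in RHS](dim_jiE lqu qu) -[dim u q]dimU.
rewrite (@dim_trans _ (u `|` p)) ?leUl ?leUx ?leUl // dimU (dim_jiE lpu pxp).
have -> : u `|` q = (u `|` p) `|` q.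
  by rewrite joinAC; apply/esym/join_l.
by rewrite dimU (dim_jiE lqup qup).
Qed.

(* If q <= x `|` y lies below neither x nor y, then q D r for some r <= x not
   below y, so that w q is absorbed: this gives the relation
   Delta(x `&` y, x) = Delta(y, x `|` y). *)
Lemma dim_hom (M : nmodType) (w : L -> M) :
  (forall p q, join_dep p q -> (w p + w q = w q)%R) ->
  exists h : Dim L -> M,
    [/\ h 0%R = 0%R, {morph h : a b / (a + b)%R} &
        forall q, join_irreducible q -> h (dim_ji q) = w q].
Proof.
move=> wD.
pose W x y := (\sum_(q | [&& join_irreducible q, q <= y & ~~ (q <= x)]) w q)%R.
have Wtrans x y z : x <= y -> y <= z -> W x z = (W x y + W y z)%R.
  move=> xy yz; rewrite /W (bigID (<= y)) /=; congr (_ + _)%R; apply: eq_bigl => q.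
    case: (boolP (q <= y)) => qy; rewrite /= ?andbF //.
    by rewrite (le_trans qy yz) !andbT.
  case: (boolP (q <= y)) => qy; rewrite /= ?andbF ?andbT //.
  by rewrite [q <= x](contraNF _ qy) ?andbT // => /le_trans; apply.
have Wtransp x y : W (x `&` y) x = W y (y `|` x).
  rewrite [RHS](bigID (<= x)) /=.
  have -> : (\sum_(q | [&& join_irreducible q, q <= y `|` x & ~~ (q <= y)]
      && (q <= x)) w q)%R = W (x `&` y) x.
    apply: eq_bigl => q; rewrite lexI.
    case: (boolP (q <= x)) => qx; rewrite /= ?andbF //.
    by rewrite (lexU2 _) ?qx ?orbT // andbT.
  rewrite big_absorb // => p /andP[/and3P[jp pyx py] px].
  have [z [yz pz zmax]] := ex_maximal_avoiding py.
  have xz : ~~ (x <= z).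
    by apply: contra pz => xz; apply: le_trans pyx _; rewrite leUx yz.
  have [r [pr rx rz]] := join_dep_below jp pz zmax xz px.
  exists r; last exact: wD.
  case/and4P: pr => _ _ -> _; rewrite rx lexI rx /=.
  by apply: contra rz => /le_trans; apply.
pose g (u : dim_gen L) := W (val u).1 (val u).2.
have gR u v : dim_rel u v -> (\sum_(e <- u) g e = \sum_(e <- v) g e)%R.
  case=> [x|x y z xy yz|x y]; rewrite ?big_cons ?big_nil ?addr0 /g /=.
  - by rewrite /W big1 // => q /and3P[_ ->].
  - exact: Wtrans.
  - by rewrite Wtransp joinC.
have [h [h0 hD hg]] := pres_lift gR.
exists h; split=> // q jq.
rewrite /dim_ji -(DeltaE (lower_le q)) hg /g /= /W (big_pred1 q) // => r /=.
apply/and3P/eqP => [[jr rq nrq]|->]; last first.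
  by split=> //; rewrite (lt_geF jq).
by apply/eqP; apply: contraR nrq => nr; apply: le_lower.
Qed.

Lemma join_depT_absorb (M : nmodType) (w : L -> M) :
  (forall p q, join_dep p q -> (w p + w q = w q)%R) ->
  forall p q, join_depT p q -> (w p + w q = w q)%R.
Proof.
move=> wD p q /existsP[r /andP[pr /connectP[s rs ->]]].
elim: s p r pr rs => [|t s IH] p r pr /=; first by move=> _; apply: wD.
by move=> /andP[rt ts]; rewrite -(IH _ _ rt ts) addrA (wD _ _ pr).
Qed.

Lemma dim_span (a : Dim L) :
  exists n : L -> nat, a = (\sum_(q | join_irreducible q) dim_ji q *+ n q)%R.
Proof.
pose P (a : Dim L) :=
  exists n : L -> nat, a = (\sum_(q | join_irreducible q) dim_ji q *+ n q)%R.
have P0 : P 0%R by exists (fun=> 0%N); rewrite big1 // => q _; rewrite mulr0n.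
have PD b c : P b -> P c -> P (b + c)%R.
  move=> [m ->] [n ->]; exists (fun q => m q + n q)%N.
  by rewrite -big_split; apply: eq_bigr => q _; rewrite mulrnDr.
have Pji q : join_irreducible q -> P (dim_ji q).
  move=> jq; exists (fun r => (r == q) : nat).
  rewrite (bigD1 q) //= eqxx mulr1n big1 ?addr0 // => r /andP[_ /negPf ->].
  by rewrite mulr0n.
(* Induction on the number of elements below [y] and not below [x]: some [r <= y] has [lower r] but
   not [r] below [x], and joining it to [x] costs exactly [r]. *)
have Pdim x y : x <= y -> P (dim x y).
  have [n] := ubnP #|[set q | (q <= y) && ~~ (q <= x)]|.
  elim: n x => // n IH x xn xy.
  have [->|nxy] := eqVneq x y; first by rewrite dim_id.
  have nyx : ~~ (y <= x) by apply: contra nxy => yx; rewrite eq_le xy.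
  have [r [jr ry nrx rx]] := join_irreducible_below nyx.
  rewrite (@dim_trans _ (x `|` r)) ?leUl ?leUx ?xy // dimU dim_jiE //.
  apply: PD; first exact: Pji.
  apply: IH; last by rewrite leUx xy.
  rewrite ltnS in xn; apply: leq_trans xn; apply: proper_card.
  apply/properP; split; last by exists r; rewrite !inE ?ry // leUr.
  apply/subsetP => q; rewrite !inE => /andP[-> /=]; apply: contra => qx.
  exact: le_trans qx (leUl _ _).
rewrite -/(P a) -(pres_reprK a); elim: (pres_repr a) => [|[[x y] xy] s IH] //.
rewrite -cat1s pres_classD; apply: PD IH.
by have := Pdim x y xy; rewrite -(DeltaE xy).
Qed.

End Dimension.

(* [None] stands for infinity. *)
Definition natinf : Type := option nat.
HB.instance Definition _ := Choice.on natinf.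

Definition natinf_add (a b : natinf) : natinf :=
  if a is Some m then if b is Some n then Some (m + n)%N else None else None.

Lemma natinf_addA : associative natinf_add.
Proof. by move=> [a|] [b|] [c|] //=; rewrite addnA. Qed.

Lemma natinf_addC : commutative natinf_add.
Proof. by move=> [a|] [b|] //=; rewrite addnC. Qed.

Lemma natinf_add0 : left_id (Some 0%N) natinf_add.
Proof. by case. Qed.

HB.instance Definition _ :=
  GRing.isNmodule.Build natinf natinf_addA natinf_addC natinf_add0.

Lemma natinf_Some_mulrn m n : ((Some m : natinf) *+ n = Some (m * n)%N)%R.
Proof. by elim: n => [|n IH]; rewrite ?muln0 // mulrS IH mulnS. Qed.

Lemma natinf_None_mulrn n : (0 < n)%N -> ((None : natinf) *+ n = None)%R.
Proof. by case: n => // n _; rewrite mulrS. Qed.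

(** * Weights, normal forms and strong separativity *)

Section Separation.
Variables (d : Order.disp_t) (L : finTBLatticeType d).
Implicit Types (p q r : L) (m n : L -> nat).

Definition height p q : natinf :=
  if join_depT p q then None else Some (p == q : nat).

(** If p D^+ r, infinity absorbs everything; otherwise neither p D^+ q nor p = q is possible, so [q]
    has weight 0. *)
Lemma height_absorb p q r :
  join_dep q r -> (height p q + height p r = height p r)%R.
Proof.
move=> qr; rewrite /height; have [pr|pr] := boolP (join_depT p r).
  by case: ifP.
rewrite ifN; last first.
  by apply: contra pr => pq; apply: join_depT_trans pq (join_depT_dep qr).
have -> : p == q = false; last by [].
by apply: contraNF pr => /eqP ->; apply: join_depT_dep.
Qed.

Lemma dim_height p : exists h : Dim L -> natinf,
  [/\ h 0%R = 0%R, {morph h : a b / (a + b)%R} &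
      forall q, join_irreducible q -> h (dim_ji q) = height p q].
Proof. by apply: dim_hom => q r; apply: height_absorb. Qed.

(** On a cycle through [p] the generator [p] absorbs itself and is idempotent, while the weight
    [height p] sends it to infinity, so it is not 0. *)
Lemma no_idempotent_acyclic : join_semidistributive L ->
  no_nonzero_idempotent (Dim L) -> join_dep_acyclic L.
Proof.
move=> hL noidem p; apply/negP => pp; have jp := join_depT_ji pp.
have pp2 := join_depT_absorb (join_dep_absorb hL) pp.
have [h [h0 _ hE]] := dim_height p.
have := hE _ jp; rewrite (noidem (dim_ji p)) ?mulr2n //.
by rewrite h0 /height pp.
Qed.

Definition comb n : Dim L := (\sum_(q | join_irreducible q) dim_ji q *+ n q)%R.

Definition dominated n p := [exists q, join_depT p q && (0 < n q)%N].

(** The weights thus recover the coefficient at every undominated [p] from the element [comb n]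
    alone; acyclicity is what gives [p] itself the weight 1. *)
Lemma height_comb p n (h : Dim L -> natinf) :
  join_dep_acyclic L -> join_irreducible p ->
  h 0%R = 0%R -> {morph h : a b / (a + b)%R} ->
  (forall q, join_irreducible q -> h (dim_ji q) = height p q) ->
  h (comb n) = if dominated n p then None else Some (n p).
Proof.
move=> acyc jp h0 hD hE.
have hM a k : h (a *+ k)%R = (h a *+ k)%R.
  by elim: k => [|k IH]; rewrite ?mulr0n // !mulrS hD IH.
have -> : h (comb n) = (\sum_(q | join_irreducible q) height p q *+ n q)%R.
  by rewrite /comb (big_morph h hD h0); apply: eq_bigr => q jq; rewrite hM hE.
case: ifPn => [/existsP[q /andP[pq nq]]|nd].
  rewrite (bigD1 q) ?(join_depT_ji pq) //= /height pq natinf_None_mulrn //.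
rewrite (bigD1 p) //= big1 => [|q /andP[jq qp]].
  by rewrite addr0 /height (negPf (acyc p)) eqxx natinf_Some_mulrn mul1n.
rewrite /height; case: ifPn => [pq|_].
  move/existsPn/(_ q): nd; rewrite pq /= lt0n negbK => /eqP ->.
  by rewrite mulr0n.
by rewrite eq_sym (negPf qp) natinf_Some_mulrn mul0n.
Qed.

Lemma ex_undominated p n : join_dep_acyclic L -> dominated n p ->
  exists q, [/\ join_depT p q, (0 < n q)%N & ~~ dominated n q].
Proof.
move=> acyc; move: p; apply: (join_dep_ind acyc) => p IH /existsP[q /andP[pq nq]].
have [dq|ndq] := boolP (dominated n q); last by exists q.
have [r [qr nr ndr]] := IH q pq dq.
by exists r; split=> //; apply: join_depT_trans qr.
Qed.

(** This is the normal form: following D^+ as far as possible within the support of [n] leads to an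
    undominated term that absorbs the dominated one. *)
Lemma comb_undominated n : join_semidistributive L -> join_dep_acyclic L ->
  comb n = (\sum_(q | join_irreducible q && ~~ dominated n q)
              dim_ji q *+ n q)%R.
Proof.
move=> hL acyc; rewrite /comb (bigID (dominated n)) /= addrC big_absorb //.
move=> p /andP[jp dp]; have [q [pq nq ndq]] := ex_undominated acyc dp.
exists q; first by rewrite (join_depT_ji pq).
by apply: absorb_mulrn => //; apply: join_depT_absorb pq; apply: join_dep_absorb.
Qed.

Lemma acyclic_strongly_separative : join_semidistributive L ->
  join_dep_acyclic L -> strongly_separative (Dim L).
Proof.
move=> hL acyc a b.
have [n ->] := dim_span a; have [m ->] := dim_span b; rewrite -!/(comb _) => e.
(* The weight [height p] makes the right side [b *+ 2] finite, so the left side is finite too and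
   the coefficients cancel in nat. *)
have undom p : join_irreducible p -> ~~ dominated m p ->
    ~~ dominated n p /\ n p = m p.
  move=> jp ndm; have [h [h0 hD hE]] := dim_height p.
  have hC k := height_comb k acyc jp h0 hD hE.
  have := congr1 h e; rewrite mulr2n !hD !hC (negPf ndm).
  by case: ifP => // _ /= [] /addIn.
(* From right to left, an undominated element of the support of [m] is used, since both coefficients
   agree there. *)
have top p : join_irreducible p -> dominated n p = dominated m p.
  move=> jp; apply/idP/idP => [dn|dm].
    by apply: contraLR dn => /(undom p jp)[].
  have [q [pq mq ndq]] := ex_undominated acyc dm.
  have [_ nmq] := undom q (join_depT_ji pq) ndq.
  by apply/existsP; exists q; rewrite pq nmq.
rewrite (comb_undominated n) // (comb_undominated m) //.
apply: eq_big => [p|p /andP[jp ndn]].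
  by case: (boolP (join_irreducible p)) => //= /top ->.
by case: (undom p jp) => [|_ ->] //; rewrite -top.
Qed.

Lemma strongly_separative_no_idempotent (M : nmodType) :
  strongly_separative M -> no_nonzero_idempotent M.
Proof. by move=> sep x xx; apply/esym/sep; rewrite add0r xx. Qed.

End Separation.

(** * Free lattices and lower bounded homomorphisms *)

Section LatticeMorphisms.
Variables (d d' : Order.disp_t) (F : latticeType d) (M : latticeType d').
Variable f : F -> M.
Hypotheses (fI : {morph f : x y / x `&` y}) (fU : {morph f : x y / x `|` y}).

Lemma morph_meet_homo : {homo f : x y / x <= y}.
Proof. by move=> x y /meet_idPl <-; rewrite fI leIr. Qed.

Lemma lmorphismP : exists h : {lmorphism F -> M}, h =1 f.
Proof.
pose mo := Order.isOrderMorphism.Build d F d' M f morph_meet_homo.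
pose mi := Order.isMeetLatticeMorphism.Build d F d' M f fI.
pose mu := Order.isJoinLatticeMorphism.Build d F d' M f fU.
pose h : {lmorphism F -> M} := HB.pack f mo mi mu.
by exists h.
Qed.
End LatticeMorphisms.

(** * The free lattice as a quotient of terms *)

Section FreeLattice.
Variable I : Type.

Inductive lterm : Type :=
| LVar of I
| LMeet of lterm & lterm
| LJoin of lterm & lterm.

HB.instance Definition _ := gen_eqMixin lterm.
HB.instance Definition _ := gen_choiceMixin lterm.

(** The least preorder on terms for which [LMeet] and [LJoin] are greatest lower and least upper
    bounds, so that every evaluation in a lattice respects it. *)
Inductive lterm_le : lterm -> lterm -> Prop :=
| lterm_le_refl s : lterm_le s s
| lterm_le_trans t s u : lterm_le s t -> lterm_le t u -> lterm_le s u
| lterm_meetl s t : lterm_le (LMeet s t) s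
| lterm_meetr s t : lterm_le (LMeet s t) t
| lterm_meet u s t : lterm_le u s -> lterm_le u t -> lterm_le u (LMeet s t)
| lterm_joinl s t : lterm_le s (LJoin s t)
| lterm_joinr s t : lterm_le t (LJoin s t)
| lterm_join u s t : lterm_le s u -> lterm_le t u -> lterm_le (LJoin s t) u.

Definition lterm_eqv (s t : lterm) : bool :=
  `[< lterm_le s t /\ lterm_le t s >].

Lemma lterm_eqv_refl : reflexive lterm_eqv.
Proof. by move=> s; apply/asboolP; split; apply: lterm_le_refl. Qed.

Lemma lterm_eqv_sym : symmetric lterm_eqv.
Proof. by move=> s t; apply/asboolP/asboolP => -[]. Qed.

Lemma lterm_eqv_trans : transitive lterm_eqv.
Proof.
move=> t s u /asboolP[st ts] /asboolP[tu ut]; apply/asboolP.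
by split; [apply: lterm_le_trans st tu | apply: lterm_le_trans ut ts].
Qed.

Canonical lterm_equiv :=
  EquivRel lterm_eqv lterm_eqv_refl lterm_eqv_sym lterm_eqv_trans.

Definition free_lat : Type := {eq_quot lterm_equiv}.
HB.instance Definition _ := Choice.on free_lat.

Definition free_class (t : lterm) : free_lat := \pi_({eq_quot lterm_equiv}) t.
Definition free_repr (a : free_lat) : lterm := repr (a : {eq_quot lterm_equiv}).

Lemma free_reprK : cancel free_repr free_class.
Proof. by move=> a; exact: reprK. Qed.

Lemma free_classP s t :
  free_class s = free_class t <-> lterm_le s t /\ lterm_le t s.
Proof.
split; first by move=> /eqmodP /asboolP.
by move=> st; apply/eqmodP/asboolP.
Qed.

Definition free_le (a b : free_lat) : bool :=
  `[< lterm_le (free_repr a) (free_repr b) >].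

Lemma free_leE s t : free_le (free_class s) (free_class t) <-> lterm_le s t.
Proof.
have rK u : lterm_le (free_repr (free_class u)) u /\
            lterm_le u (free_repr (free_class u)).
  by apply/free_classP; rewrite free_reprK.
have [s1 s2] := rK s; have [t1 t2] := rK t.
split=> [/asboolP st|st].
  by apply: lterm_le_trans s2 _; apply: lterm_le_trans st t1.
by apply/asboolP; apply: lterm_le_trans s1 _; apply: lterm_le_trans st t2.
Qed.

Lemma free_le_refl : reflexive free_le.
Proof. by move=> a; apply/asboolP; apply: lterm_le_refl. Qed.

Lemma free_le_anti : antisymmetric free_le.
Proof.
move=> a b /andP[/asboolP ab /asboolP ba].
by rewrite -(free_reprK a) -(free_reprK b); apply/free_classP.
Qed.

Lemma free_le_trans : transitive free_le.
Proof.
by move=> b a c /asboolP ab /asboolP bc; apply/asboolP; apply: lterm_le_trans bc.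
Qed.

HB.instance Definition _ := Order.Le_isPOrder.Build (Order.Disp tt tt) free_lat
  free_le_refl free_le_anti free_le_trans.

Definition free_meet (a b : free_lat) : free_lat :=
  free_class (LMeet (free_repr a) (free_repr b)).
Definition free_join (a b : free_lat) : free_lat :=
  free_class (LJoin (free_repr a) (free_repr b)).

Lemma free_meetP a b c : (a <= free_meet b c) = (a <= b) && (a <= c).
Proof.
rewrite -[a]free_reprK -[b in RHS]free_reprK -[c in RHS]free_reprK.
apply/idP/andP => [/free_leE h|[/free_leE h1 /free_leE h2]].
  split; apply/free_leE; apply: lterm_le_trans h _.
    exact: lterm_meetl.
  exact: lterm_meetr.
by apply/free_leE; apply: lterm_meet.
Qed.

Lemma free_joinP a b c : (free_join a b <= c) = (a <= c) && (b <= c).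
Proof.
rewrite -[c]free_reprK -[a in RHS]free_reprK -[b in RHS]free_reprK.
apply/idP/andP => [/free_leE h|[/free_leE h1 /free_leE h2]].
  split; apply/free_leE; apply: lterm_le_trans h.
    exact: lterm_joinl.
  exact: lterm_joinr.
by apply/free_leE; apply: lterm_join.
Qed.

HB.instance Definition _ :=
  Order.POrder_MeetJoin_isLattice.Build (Order.Disp tt tt) free_lat
    free_meetP free_joinP.

Definition free_var (i : I) : free_lat := free_class (LVar i).

Lemma free_ind (P : free_lat -> Prop) :
  (forall i, P (free_var i)) ->
  (forall a b, P a -> P b -> P (a `&` b)) ->
  (forall a b, P a -> P b -> P (a `|` b)) -> forall a, P a.
Proof.
move=> PX PI PU a; rewrite -(free_reprK a).
elim: (free_repr a) => [i|s Ps t Pt|s Ps t Pt]; first exact: PX.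
  have -> : free_class (LMeet s t) = free_class s `&` free_class t; last exact: PI.
  apply/le_anti; rewrite lexI -andbA; apply/and3P; split.
  - exact/free_leE/lterm_meetl.
  - exact/free_leE/lterm_meetr.
  apply/free_leE; apply: lterm_meet; apply/free_leE.
    exact: (leIl (free_class s) (free_class t)).
  exact: (leIr (free_class t) (free_class s)).
have -> : free_class (LJoin s t) = free_class s `|` free_class t; last exact: PU.
apply/le_anti; rewrite leUx; apply/andP; split; last apply/andP; last split.
- apply/free_leE; apply: lterm_join; apply/free_leE.
    exact: (leUl (free_class s) (free_class t)).
  exact: (leUr (free_class t) (free_class s)).
- exact/free_leE/lterm_joinl.
- exact/free_leE/lterm_joinr.
Qed.

Fixpoint lterm_eval d (M : latticeType d) (g : I -> M) (t : lterm) : M :=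
  match t with
  | LVar i => g i
  | LMeet s t => lterm_eval g s `&` lterm_eval g t
  | LJoin s t => lterm_eval g s `|` lterm_eval g t
  end.

Lemma lterm_eval_le d (M : latticeType d) (g : I -> M) s t :
  lterm_le s t -> lterm_eval g s <= lterm_eval g t.
Proof.
elim=> {s t} [s|t s u _ IH1 _ IH2|s t|s t|u s t _ IH1 _ IH2|s t|s t
  |u s t _ IH1 _ IH2] /=; rewrite ?lexI ?leUx ?leIl ?leIr ?leUl ?leUr ?IH1 //.
exact: le_trans IH1 IH2.
Qed.

Lemma free_latP : free_lattice free_var.
Proof.
move=> d M g; split; last first.
  move=> h1 h2 h1X h2X; apply: free_ind => [i|a b e1 e2|a b e1 e2].
  - by rewrite h1X h2X.
  - by rewrite !omorphI; congr (_ `&` _).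
  - by rewrite !omorphU; congr (_ `|` _).
pose f (a : free_lat) := lterm_eval g (free_repr a).
have fE t : f (free_class t) = lterm_eval g t.
  have /free_classP[h1 h2] := free_reprK (free_class t).
  by apply/le_anti; rewrite !lterm_eval_le.
have fI : {morph f : a b / a `&` b} by move=> a b; rewrite [LHS]fE.
have fU : {morph f : a b / a `|` b} by move=> a b; rewrite [LHS]fE.
have [h hE] := lmorphismP fI fU.
by exists h => i; rewrite hE fE.
Qed.

End FreeLattice.

Section FiniteBounds.
Variables (d : Order.disp_t) (F : latticeType d).
Implicit Types (x y b : F) (s : seq F).

(** A lattice such as the free one is given without bounds, so iterated joins and meets start from a
    base [b]. *)
Definition joins_from b s := foldr Order.join b s.
Definition meets_from b s := foldr Order.meet b s.

Lemma le_joins_from b s x : x \in s -> x <= joins_from b s.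
Proof.
elim: s => //= y s IH; rewrite inE => /orP[/eqP ->|/IH xs]; first exact: leUl.
exact: le_trans xs (leUr _ _).
Qed.

Lemma joins_from_le b s x :
  b <= x -> (forall y, y \in s -> y <= x) -> joins_from b s <= x.
Proof.
move=> bx; elim: s => //= y s IH sx; rewrite leUx sx ?mem_head //=.
by apply: IH => z zs; apply: sx; rewrite inE zs orbT.
Qed.

Lemma meets_from_le b s x : x \in s -> meets_from b s <= x.
Proof.
elim: s => //= y s IH; rewrite inE => /orP[/eqP ->|/IH xs]; first exact: leIl.
exact: le_trans (leIr _ _) xs.
Qed.

Lemma meets_from_ind (P : F -> Prop) b s :
  (forall x y, P x -> P y -> P (x `&` y)) -> P b ->
  (forall y, y \in s -> P y) -> P (meets_from b s).
Proof.
move=> PI Pb; elim: s => //= y s IH sP; apply: PI.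
  by apply: sP; rewrite mem_head.
by apply: IH => z zs; apply: sP; rewrite inE zs orbT.
Qed.

End FiniteBounds.

(** * Least preimages from acyclicity *)

Section LowerBoundedness.
Variables (d : Order.disp_t) (L : finTBLatticeType d).
Implicit Types (a p q r x y z : L).

Definition least_preimage d' (F : latticeType d') (f : F -> L) a (m : F) :=
  a <= f m /\ forall t, a <= f t -> m <= t.

Lemma acyclic_lower_bounded_image :
  join_dep_acyclic L -> lower_bounded_image_of_free L.
Proof.
move=> acyc; pose I := 'I_#|L|; pose X : I -> free_lat I := @free_var I.
have [[f fX] _] := @free_latP I d L (fun i => enum_val i).
have fXr y : f (X (enum_rank y)) = y by rewrite fX enum_rankK.
exists #|L|, (Order.Disp tt tt), (free_lat I), X; split; first exact: free_latP.
exists f; split; last by move=> y; exists (X (enum_rank y)).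
(* The meet of all generators is the least element; the base is itself a generator. *)
pose bot := meets_from (X (enum_rank \bot)) (map X (enum I)).
have botP t : bot <= t.
  move: t; apply: free_ind => [i|a b ha hb|a b ha hb].
  - by apply: meets_from_le; rewrite map_f ?mem_enum.
  - by rewrite lexI ha.
  - exact: le_trans ha (leUl _ _).
have ji_least p : join_irreducible p -> exists m, least_preimage f p m.
  move: p; apply: (join_dep_ind acyc) => p IH jp.
  have /choice[m mP] q : exists m, join_dep p q -> least_preimage f q m.
    have [pq|npq] := boolP (join_dep p q); last by exists bot.
    have [|m mq] := IH q (join_depT_dep pq); first by case/and4P: pq.
    by exists m.
  pose w (C : {set L}) := joins_from bot (map m (enum C)).
  pose cover (C : {set L}) :=
    [forall q in C, join_dep p q] && (p <= \join_(q in C) q).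
  have wP C : cover C -> p <= f (w C).
    case/andP => /forall_inP Cp pC; apply: le_trans pC _; apply/joinsP => q qC.
    have [qm _] := mP q (Cp q qC); apply: le_trans qm _; apply: omorph_le.
    by apply: le_joins_from; rewrite map_f ?mem_enum.
  (* The least preimage of [p] is the meet of the generators sent above [p] and of the [w C] for
     covers [C]; the base is the generator sent to [p] itself. *)
  pose s := [seq X i | i <- enum I & p <= f (X i)] ++
            [seq w C | C <- enum {set L} & cover C].
  exists (meets_from (X (enum_rank p)) s); split.
    apply: (@meets_from_ind _ _ (fun t => p <= f t)) => [t u pt pu||t].
    - by rewrite omorphI lexI pt.
    - by rewrite fXr.
    rewrite mem_cat => /orP[/mapP[i]|/mapP[C]]; rewrite mem_filter.
      by move=> /andP[pi _] ->.
    by move=> /andP[pC _] ->; apply: wP.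
  apply: free_ind => [i pi|t u ht hu|t u ht hu].
  - apply: meets_from_le; rewrite mem_cat map_f //.
    by rewrite mem_filter pi mem_enum.
  - by rewrite omorphI !lexI => /andP[/ht -> /hu ->].
  have [pt _|pt] := boolP (p <= f t).
    exact: le_trans (ht pt) (leUl _ _).
  have [pu _|pu] := boolP (p <= f u).
    exact: le_trans (hu pu) (leUr _ _).
  rewrite omorphU => ptu.
  (* These successors cover [p]: otherwise some [z] above their join is maximal avoiding [p], and a
     part of [f t] or [f u] outside [z] would yield a further member of [C] not below [z]. So both
     images are below [z], and then so is [p]. *)
  pose C := [set q | join_dep p q && ((q <= f t) || (q <= f u))].
  have CP : cover C.
    apply/andP; split; first by apply/forall_inP => q; rewrite inE => /andP[].
    apply/negPn/negP => pC; have [z [Cz pz zmax]] := ex_maximal_avoiding pC.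
    have absurd v : ~~ (p <= v) -> (v = f t) \/ (v = f u) -> v <= z.
      move=> pv vtu; apply/negPn/negP => vz.
      have [r [pr rv rz]] := join_dep_below jp pz zmax vz pv.
      case/negP: rz; apply: le_trans Cz; apply: (joins_sup id).
      by rewrite inE pr; case: vtu rv => -> ->; rewrite ?orbT.
    case/negP: pz; apply: le_trans ptu _; rewrite leUx.
    by rewrite !absurd //; [right | left].
  apply: (@le_trans _ _ (w C)).
    apply: meets_from_le; rewrite mem_cat; apply/orP; right.
    by rewrite map_f // mem_filter CP mem_enum.
  apply: joins_from_le => // v /mapP[q]; rewrite mem_enum inE => qC ->.
  case/andP: qC => pq; have [_ mq] := mP q pq.
  by case/orP => /mq h; apply: le_trans h _; rewrite ?leUl ?leUr.
have /choice[m mP] q : exists m, join_irreducible q -> least_preimage f q m.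
  have [/ji_least[m mq]|_] := boolP (join_irreducible q); last by exists bot.
  by exists m.
move=> a; right.
(* Every element is the join of the join-irreducibles below it, so their least preimages join to
   that of [a]. *)
pose S := [seq m q | q <- enum L & join_irreducible q && (q <= a)].
exists (joins_from bot S).
  apply/negPn/negP => /join_irreducible_below[r [jr ra rm _]].
  case/negP: rm; have [rr _] := mP r jr; apply: le_trans rr _.
  apply: omorph_le; apply: le_joins_from.
  by rewrite map_f // mem_filter jr ra mem_enum.
move=> t at_; apply: joins_from_le => // v /mapP[q].
rewrite mem_filter => /andP[/andP[jq qa] _] ->.
by have [_] := mP q jq; apply; apply: le_trans qa at_.
Qed.

End LowerBoundedness.

(** * Increasing sequences of subsets, and acyclicity from lower boundedness *)

Section Stages.
Variables (d : Order.disp_t) (L : finTBLatticeType d).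
Implicit Types (a x y : L).

(* Joins of elements of one stage are only reached at the next one, so that an
   element may enter a sequence with a given limit arbitrarily late. *)
Definition stage_closed (A : nat -> {set L}) :=
  forall k a, a <= \join_(x in A k) x -> a \in A k.+1.

Record stages : Type := Stages {
  stage :> nat -> {set L};
  stageP : stage_closed stage }.
Implicit Types (A B C : stages).

HB.instance Definition _ := gen_eqMixin stages.
HB.instance Definition _ := gen_choiceMixin stages.

Lemma stages_eq A B : (forall k, A k = B k) -> A = B.
Proof.
case: A B => [A HA] [B HB] /= AB; have e : A = B by apply: funext.
by case: _ / e HB => HB; congr Stages; apply: Prop_irrelevance.
Qed.

Definition stages_le A B : bool := `[< forall k, A k \subset B k >].

Lemma stages_le_refl : reflexive stages_le.
Proof. by move=> A; apply/asboolP. Qed.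

Lemma stages_le_anti : antisymmetric stages_le.
Proof.
move=> A B /andP[/asboolP AB /asboolP BA]; apply: stages_eq => k.
by apply/eqP; rewrite eqEsubset AB BA.
Qed.

Lemma stages_le_trans : transitive stages_le.
Proof.
move=> B A C /asboolP AB /asboolP BC; apply/asboolP => k.
exact: subset_trans (AB k) (BC k).
Qed.

HB.instance Definition _ := Order.Le_isPOrder.Build (Order.Disp tt tt) stages
  stages_le_refl stages_le_anti stages_le_trans.

Lemma stages_leP A B : reflect (forall k, A k \subset B k) (A <= B).
Proof. exact: asboolP. Qed.

Lemma joins_subset (S T : {set L}) : S \subset T ->
  \join_(x in S) x <= \join_(x in T) x.
Proof.
by move=> /subsetP ST; apply/joinsP => x /ST xT; apply: (joins_sup id).
Qed.

Lemma stages_meet_closed A B : stage_closed (fun k => A k :&: B k).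
Proof.
by move=> k a ak; rewrite inE !stageP //;
  apply: le_trans ak _; apply: joins_subset; rewrite ?subsetIl ?subsetIr.
Qed.

Definition stages_meet A B := Stages (@stages_meet_closed A B).

(** Besides [A] and [B], a stage receives only what closure forces from the previous one; this makes
    the sequence the least closed one above both. *)
Fixpoint stage_join A B k : {set L} :=
  if k is j.+1 then
    A k :|: B k :|: [set a | a <= \join_(x in stage_join A B j) x]
  else A 0 :|: B 0.

Lemma stages_join_closed A B : stage_closed (stage_join A B).
Proof. by move=> k a ak; rewrite !inE ak orbT. Qed.

Definition stages_join A B := Stages (@stages_join_closed A B).

Lemma stages_meetP A B C : (A <= stages_meet B C) = (A <= B) && (A <= C).
Proof.
apply/stages_leP/andP => [h|[/stages_leP h1 /stages_leP h2] k].
  by split; apply/stages_leP => k; apply: subset_trans (h k) _;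
    rewrite ?subsetIl ?subsetIr.
by rewrite subsetI h1 h2.
Qed.

Lemma stages_joinP A B C : (stages_join A B <= C) = (A <= C) && (B <= C).
Proof.
apply/stages_leP/andP => [h|[/stages_leP h1 /stages_leP h2]].
  have sub k : A k :|: B k \subset C k.
    by apply: subset_trans (h k); case: k => [|k] //=; rewrite subsetUl.
  by split; apply/stages_leP => k; move: (sub k); rewrite subUset => /andP[].
elim=> [|k IH] /=; first by rewrite subUset h1 h2.
rewrite !subUset h1 h2 /=; apply/subsetP => a; rewrite inE => ak.
by apply: stageP; apply: le_trans ak (joins_subset IH).
Qed.

HB.instance Definition _ :=
  Order.POrder_MeetJoin_isLattice.Build (Order.Disp tt tt) stages
    stages_meetP stages_joinP.

Lemma stage_homo A j k : (j <= k)%N -> A j \subset A k.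
Proof.
move=> /subnKC <-; elim: (k - j)%N => [|i IH]; rewrite ?addn0 // addnS.
apply: subset_trans IH _; apply/subsetP => a ai.
by apply: stageP; apply: (joins_sup id).
Qed.

Definition limit A : L := \join_(a | `[< exists k, a \in A k >]) a.

(** As [L] is finite, all elements that ever appear are present at some stage [K], and stage [K.+1]
    then contains everything below their join. *)
Lemma le_limit A a : a <= limit A <-> exists k, a \in A k.
Proof.
split=> [aA|[k ak]]; last by apply: (joins_sup id); apply/asboolP; exists k.
have /choice[k kP] x : exists k, forall j, x \in A j -> x \in A k.
  have [[k xk]|nx] := pselect (exists k, x \in A k); first by exists k.
  by exists 0%N => j xj; case: nx; exists j.
pose K := \max_x k x; exists K.+1; apply: stageP; apply: le_trans aA _.
apply/joinsP => x /asboolP[j xj]; apply: (joins_sup id).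
by apply: (subsetP (stage_homo A (leq_bigmax x))); apply: kP xj.
Qed.

Lemma stage_le_limit A k a : a \in A k -> a <= limit A.
Proof. by move=> ak; apply/le_limit; exists k. Qed.

Lemma limit_meet : {morph limit : A B / A `&` B}.
Proof.
move=> A B; apply/le_anti/andP; split.
  have /le_limit[k] := lexx (limit (A `&` B)); rewrite inE => /andP[ak bk].
  by rewrite lexI !(stage_le_limit (k := k)).
have /le_limit[i ai] := leIl (limit A) (limit B).
have /le_limit[j bj] := leIr (limit B) (limit A).
apply/le_limit; exists (maxn i j); rewrite inE.
rewrite (subsetP (stage_homo A (leq_maxl i j))) //.
by rewrite (subsetP (stage_homo B (leq_maxr i j))).
Qed.

(** The hypotheses stop at stage [k] because, in the argument along D, one of the two sequences is
    known to stay below [x] only up to a given stage. *)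
Lemma stage_join_le A B k x :
  (forall j a, (j <= k)%N -> a \in A j -> a <= x) ->
  (forall j a, (j <= k)%N -> a \in B j -> a <= x) ->
  forall a, a \in stage_join A B k -> a <= x.
Proof.
elim: k => [|k IH] Ax Bx a /=.
  by rewrite inE => /orP[/Ax|/Bx]; apply.
rewrite !inE => /orP[/orP[/Ax|/Bx]|ak]; try exact.
apply: le_trans ak _; apply/joinsP => y; apply: IH => j b jk.
  by apply: Ax; apply: leqW.
by apply: Bx; apply: leqW.
Qed.

Lemma limit_join : {morph limit : A B / A `|` B}.
Proof.
move=> A B; apply/le_anti/andP; split.
  have /le_limit[k] := lexx (limit (A `|` B)); apply: stage_join_le => j a _ aj.
    by apply: le_trans (stage_le_limit aj) (leUl _ _).
  by apply: le_trans (stage_le_limit aj) (leUr _ _).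
have homo C D : C <= D -> limit C <= limit D.
  move=> /stages_leP CD; have /le_limit[k ck] := lexx (limit C).
  by apply/le_limit; exists k; apply: (subsetP (CD k)).
by rewrite leUx !homo ?leUl ?leUr.
Qed.

Lemma down_closed x : stage_closed (fun=> [set a | a <= x]).
Proof.
move=> _ a ax; rewrite inE; apply: le_trans ax _; apply/joinsP => y.
by rewrite inE.
Qed.

(** Constant sequences provide a section of [limit], used to lift the images of the generators. *)
Definition down x := Stages (@down_closed x).

Lemma limit_down x : limit (down x) = x.
Proof.
apply/le_anti/andP; split; last by apply/le_limit; exists 0%N; rewrite inE.
by have /le_limit[k] := lexx (limit (down x)); rewrite inE.
Qed.

Lemma lower_bounded_image_acyclic :
  lower_bounded_image_of_free L -> join_dep_acyclic L.
Proof.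
move=> [n [dF [F [X [FX [f [flb fsurj]]]]]]].
have [[k kX] _] := FX _ stages (fun i => down (f (X i))).
have [_ Xuniq] := FX d L (fun i => f (X i)).
have lk t : limit (k t) = f t.
  have kI : {morph limit \o k : x y / x `&` y}.
    by move=> x y; rewrite /= omorphI limit_meet.
  have kU : {morph limit \o k : x y / x `|` y}.
    by move=> x y; rewrite /= omorphU limit_join.
  have [h hE] := lmorphismP kI kU; rewrite -[LHS]hE; apply: Xuniq => // i.
  by rewrite hE /= kX limit_down.
have /choice[m mP] p : exists m, least_preimage f p m.
  case: (flb p) => [no|[m pm mmin]]; last by exists m.
  by have [x xp] := fsurj p; case: (no x); rewrite xp.
have fm p : f (m p) = p.
  have [pm mmin] := mP p; apply/le_anti; rewrite pm andbT.
  by have [x <-] := fsurj p; apply: omorph_le; apply: (mP (f x)).2.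
have fU : {morph f : x y / x `|` y} by exact: omorphU.
have kU : {morph k : x y / x `|` y} by exact: omorphU.
have drop p q i : join_dep p q -> p \in k (m p) i ->
    exists2 j, (j < i)%N & q \in k (m q) j.
  move=> pq pi; have [np jp jq [x [qx pxq px]]] := join_depP _ _ pq.
  have [t tx] := fsurj x.
  (* Since [t] is sent to [x], the right side is sent above [p]; applying [k] then compares the
     sequences stage by stage. *)
  have mpt : m p <= m q `|` t.
    by apply: (mP p).2; rewrite fU fm tx joinC.
  have /subsetP/(_ _ pi) : k (m p) i \subset (k (m q) `|` k t) i.
    by apply/stages_leP; rewrite -kU; apply: omorph_le.
  have tle j a : a \in k t j -> a <= x by move=> /stage_le_limit; rewrite lk tx.
  have mle j a : a \in k (m q) j -> a <= q.
    by move=> /stage_le_limit; rewrite lk fm.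
  have [//|nq] := pselect (exists2 j, (j < i)%N & q \in k (m q) j).
  (* If [q] has not appeared in [k (m q)] before stage [i], the elements present there are below [q]
     and differ from it, hence lie below [lower q]. *)
  have small j a : (j < i)%N -> a \in k (m q) j -> a <= x.
    move=> ji aj; apply: le_trans qx; apply: le_lower; first exact: mle aj.
    by apply: contra_notN nq => /eqP aq; exists j; rewrite // -{1}aq.
  move=> pj; exfalso; move: pj.
  (* Every way for [p] to enter stage [i] of the join fails: through [k (m q)] it would be below
     [q], through [k t] below [x], and through a join of the previous stage again below [x]. Stage 0
     has only the first two ways. *)
  case: i small {nq pi} => [|i] small /=; rewrite !inE.
    move=> /orP[/mle|/tle]; last exact/negP.
    by apply/negP; apply: join_dep_nle.
  move=> /orP[/orP[/mle|/tle]|pj]; last 1 first.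
  - case/negP: px; apply: le_trans pj _; apply/joinsP => y.
    by apply: stage_join_le => j a ji; [apply: small | apply: tle].
  - by apply/negP; apply: join_dep_nle.
  - exact/negP.
have dropT p q i : join_depT p q -> p \in k (m p) i ->
    exists2 j, (j < i)%N & q \in k (m q) j.
  case/existsP => r /andP[pr /connectP[s rs ->]] {q}.
  elim: s p r i pr rs => [|u s IH] p r i pr /=; first by move=> _; apply: drop.
  move=> /andP[ru us] /(drop _ _ _ pr)[j ji rj].
  by have [h hj uh] := IH _ _ _ ru us rj; exists h => //; apply: ltn_trans hj ji.
move=> p; apply/negP => pp.
have ex : exists i, p \in k (m p) i by apply/le_limit; rewrite lk fm.
case: (ex_minnP ex) => i pi imin.
by have [j ji /imin] := dropT _ _ _ pp pi; rewrite leqNgt ji.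
Qed.

End Stages.

Theorem theorem2 (d : Order.disp_t) (L : finTBLatticeType d)
    (hL : join_semidistributive L) :
  [<-> lower_bounded_image_of_free L;
       strongly_separative (Dim L);
       no_nonzero_idempotent (Dim L)].
Proof.
tfae.
- by move/lower_bounded_image_acyclic; apply: acyclic_strongly_separative.
- exact: strongly_separative_no_idempotent.
- by move/(no_idempotent_acyclic hL); apply: acyclic_lower_bounded_image.
Qed.
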